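(* Let $a_1,\dots,a_n>0$ be task lengths and let the disruption intensity be $\lambda(t)=\bar\lambda f(t)$ with $\bar\lambda>0$ and $f$ a positive differentiable function on $[0,\infty)$ with $0<\inf f\le\sup f<\infty$. Assume there exists $t_0>0$ such that $\lambda(t)=\lambda(t_0)$ for all $t>t_0$. If $a_i>t_0$ for every $1\le i\le n$, then $M_{1:n}(0)=M_{\pi(1):\pi(n)}(0)$ for every permutation $\pi$ of $\{1,\dots,n\}$.
   Context: Model: a single machine processes a finite batch of tasks one at a time in a fixed order. A task of length $c>0$ requires $c$ units of uninterrupted processing. Disruptions occur at the points of a non-homogeneous Poisson process on $[0,\infty)$ with intensity function $\lambda(t)$. If a disruption occurs while a task is being processed, all work on it is lost and that task is restarted from scratch at the disruption time (no repair time); a task is completed once it has been processed for $c$ consecutive time units with no disruption, and the machine then immediately starts the next task. For a permutation $\pi$ of $\{1,\dots,n\}$, $M_{\pi(1):\pi(n)}(t)$ denotes the expected time, measured from $t$, to complete all tasks in the order $a_{\pi(1)},\dots,a_{\pi(n)}$ when processing of $a_{\pi(1)}$ starts at time $t$; $M_{1:n}$ corresponds to the order $a_1,\dots,a_n$. *)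

(* Defs.v *)
From HB Require Import structures.
From mathcomp Require Import all_boot all_order all_algebra all_fingroup.
From mathcomp Require Import all_classical all_reals all_analysis.
Set Implicit Arguments. Unset Strict Implicit. Unset Printing Implicit Defensive.
Import Order.TTheory GRing.Theory Num.Theory.
Import numFieldNormedType.Exports.
Local Open Scope classical_set_scope.
Local Open Scope ring_scope.

Section Machine.
Variable R : realType.

Definition cum_int (lam : R -> R) (s t : R) : R :=
  Rintegral lebesgue_measure `[s, t] lam.

Definition poisson_pmf (L : R) (k : nat) : R :=
  expR (- L) * L ^+ k / (k`!)%:R.

(* N t w = number of disruptions in (0, t] on sample point w:
   a non-homogeneous Poisson process with intensity lam on [0, oo). *)
Definition is_NHPP (d : measure_display) (T : measurableType d)
  (P : probability T R) (lam : R -> R) (N : R -> T -> nat) : Prop :=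
  [/\ (forall w, N 0 w = 0%N) /\
      (forall w s t, 0 <= s -> s <= t -> (N s w <= N t w)%N),
      (forall w t, 0 <= t -> exists2 e, 0 < e &
          forall u, t <= u -> u < t + e -> N u w = N t w),
      (forall t k, 0 <= t -> measurable ([set w | N t w = k] : set T)),
      (forall s t k, 0 <= s -> s <= t ->
          P [set w | (N t w - N s w)%N = k] = (poisson_pmf (cum_int lam s t) k)%:E) &
      (forall (m : nat) (ts : nat -> R) (ks : nat -> nat),
          0 <= ts 0%N -> (forall i, (i < m)%N -> ts i <= ts i.+1) ->
          P (\big[setI/setT]_(i < m) [set w | (N (ts i.+1) w - N (ts i) w)%N = ks i])
          = (\prod_(i < m) P [set w | (N (ts i.+1) w - N (ts i) w)%N = ks i])%E)].

Definition no_disr (n : R -> nat) (r c : R) : Prop :=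
  forall u, r <= u -> u < r + c -> n u = n r.

Definition disr_at (n : R -> nat) (s r : R) : Prop :=
  s < r /\ forall u, s <= u -> u < r -> (n u < n r)%N.

Definition restart_pt (n : R -> nat) (s r : R) : Prop :=
  r = s \/ disr_at n s r.

(* completion time of a task of length c whose processing starts at s
   (+oo if it never completes) *)
Definition task_end (c s : R) (n : R -> nat) : \bar R :=
  ereal_inf [set (r + c)%:E | r in [set r | restart_pt n s r /\ no_disr n r c]].

Definition seq_end (cs : seq R) (t : R) (n : R -> nat) : \bar R :=
  foldl (fun x c => match x with EFin s => task_end c s n | _ => x end) t%:E cs.

Definition Mexp (d : measure_display) (T : measurableType d)
  (P : probability T R) (N : R -> T -> nat) (cs : seq R) (t : R) : \bar R :=
  (\int[P]_w (seq_end cs t (fun u => N u w) - t%:E))%E.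

End Machine.

(* Main.v *)
(* Cut time into cells of length [t0 / I].  Counting, for each task, the number
   of consecutive disruption-free cells it needs (rounded up or down) sandwiches
   the completion time pathwise between cell counts of a discrete machine driven
   by independent bits, with no appeal to measurability of the completion time.
   As every task is longer than [t0], no task ends before the bit probabilities
   have become constant, so the expected cell count solves explicitly to a sum
   of one term per task plus a correction depending only on the first [I] bits.
   Both bounds are therefore symmetric in the tasks, and their difference is
   [O(1 / I)]. *)
Require Import Defs.
From HB Require Import structures.
From mathcomp Require Import all_boot all_order all_algebra all_fingroup.
From mathcomp Require Import all_classical all_reals all_analysis.
From mathcomp Require Import measurable_realfun ring lra zify.
Set Implicit Arguments.
Unset Strict Implicit.
Unset Printing Implicit Defensive.
Import Order.TTheory GRing.Theory Num.Theory.
Import numFieldNormedType.Exports.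
Local Open Scope classical_set_scope.
Local Open Scope ring_scope.

(** * A restarting machine that reads one bit per cell *)

(* A state [(x, ks)] has accumulated [x] disruption-free cells on the current
   task; the remaining tasks need [ks] consecutive disruption-free cells. *)
Definition state := (nat * seq nat)%type.

Definition step (b : bool) (s : state) : state :=
  match s.2 with
  | [::] => (0%N, [::])
  | k :: ks =>
    if b then (if (s.1.+1 < k)%N then (s.1.+1, k :: ks) else (0%N, ks))
    else (0%N, k :: ks)
  end.

Fixpoint run (bits : nat -> bool) (ks : seq nat) (i : nat) : state :=
  if i is j.+1 then step (bits j) (run bits ks j) else (0%N, ks).

Definition busy (s : state) : bool := s.2 != [::].

Lemma busy_step b s : busy (step b s) -> busy s.
Proof. by case: s => x [|k ks]. Qed.

(** * Expected number of busy cells for independent bits *)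

Section DiscreteMachine.
Variables (R : realType) (p : nat -> R) (pbar : R) (I : nat).
Hypothesis p01 : forall i, 0 <= p i <= 1.
Hypothesis p_late : forall i, (I <= i)%N -> p i = pbar.
Hypothesis pbar01 : 0 < pbar < 1.
Hypothesis I_gt0 : (0 < I)%N.

(** Expectation of [g] at the state after [i] cells when bit [j] is set with probability [p j],
    independently. Averaging out the last bit first avoids any probability space. *)
Fixpoint Ev (ks : seq nat) (i : nat) (g : state -> R) : R :=
  if i is j.+1 then
    Ev ks j (fun s => p j * g (step true s) + (1 - p j) * g (step false s))
  else g (0%N, ks).

(** Invariant of the reachable states. Bounding the age by the elapsed cells is what rules out a
    completion within fewer than [I] cells. *)
Definition admissible (ks : seq nat) (i : nat) (s : state) : Prop :=
  [/\ (s.1 <= i)%N, suffix s.2 ks &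
      forall k ks', s.2 = k :: ks' -> (s.1 < k)%N].

Lemma suffix_all_ge ks' ks : suffix ks' ks ->
  all (fun k => (I <= k)%N) ks -> all (fun k => (I <= k)%N) ks'.
Proof. by move=> /suffixP[l ->]; rewrite all_cat => /andP[]. Qed.

Lemma admissible0 ks : all (fun k => (I <= k)%N) ks ->
  admissible ks 0 (0%N, ks).
Proof.
move=> h; split => //=; first exact: suffix_refl.
move=> k ks' e; move: h; rewrite e /= => /andP[Ik _]; exact: leq_trans Ik.
Qed.

Lemma admissible_step ks i b s : all (fun k => (I <= k)%N) ks ->
  admissible ks i s -> admissible ks i.+1 (step b s).
Proof.
move=> hks; case: s => x [|k ks1] [/= xi sk hx].
  by split => //=; exact: suffix0s.
have := suffix_all_ge sk hks => /= /andP[Ik hks1]; rewrite /step /=.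
case: b => /=; last first.
  by split => //= k' ks' [<- _]; exact: leq_trans Ik.
case: ifP => xk; first by split => //= k' ks' [<- _].
split => //=; first exact: suffix_trans (suffix_cons _ _) sk.
move=> k' ks' e; move: hks1; rewrite e /= => /andP[Ik' _].
exact: leq_trans Ik'.
Qed.

Lemma Ev_ext_admissible ks i g1 g2 : all (fun k => (I <= k)%N) ks ->
  (forall s, admissible ks i s -> g1 s = g2 s) -> Ev ks i g1 = Ev ks i g2.
Proof.
move=> hks; elim: i g1 g2 => [|i IH] g1 g2 h /=; first exact: h (admissible0 hks).
by apply: IH => s hs; rewrite !h //; exact: admissible_step.
Qed.

Lemma Ev_le_admissible ks i g1 g2 : all (fun k => (I <= k)%N) ks ->
  (forall s, admissible ks i s -> g1 s <= g2 s) -> Ev ks i g1 <= Ev ks i g2.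
Proof.
move=> hks; elim: i g1 g2 => [|i IH] g1 g2 h /=; first exact: h (admissible0 hks).
have /andP[p0 p1] := p01 i.
apply: IH => s hs; apply: lerD; apply: ler_wpM2l => //;
  rewrite ?subr_ge0 //; apply: h; exact: admissible_step.
Qed.

Lemma EvD ks i g1 g2 : Ev ks i (fun s => g1 s + g2 s) = Ev ks i g1 + Ev ks i g2.
Proof.
elim: i g1 g2 => [|i IH] g1 g2 //=.
rewrite -IH; congr Ev; apply/funext => s; ring.
Qed.

Lemma EvZ ks i c g : Ev ks i (fun s => c * g s) = c * Ev ks i g.
Proof.
elim: i g => [|i IH] g //=.
rewrite -IH; congr Ev; apply/funext => s; ring.
Qed.

(** Expected number of trials until [k] successes in a row, each trial succeeding with probability
    [pbar]. *)
Definition run_cost (k : nat) : R := (pbar ^- k - 1) / (1 - pbar).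

(* [age_gain e x]: change of the expected number of remaining cells due to
   being at cell [I - e] with age [x] instead of at cell [I] with age [0]. *)
Fixpoint age_gain (e x : nat) : R :=
  if e is e'.+1 then
    1 + p (I - e) * age_gain e' x.+1 + (1 - p (I - e)) * age_gain e' 0
  else (1 - pbar ^- x) / (1 - pbar).

(** Candidate for the expected number of busy cells still to come. The tasks enter through a
    symmetric sum, and the age correction does not see their lengths. *)
Definition value (i : nat) (s : state) : R :=
  if busy s then \sum_(k <- s.2) run_cost k + age_gain (I - i) s.1 else 0.

Lemma value_busy i s : busy s ->
  value i s = \sum_(k <- s.2) run_cost k + age_gain (I - i) s.1.
Proof. by rewrite /value => ->. Qed.

(** Past cell [I], an age of [k] saves the whole cost of a task of [k] cells, so the value does not
    jump when that task ends and the next starts at age zero. *)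
Lemma age_gain_cost k : run_cost k + age_gain 0 k = 0.
Proof. rewrite /run_cost /=; ring. Qed.

Lemma age_gain_late x :
  age_gain 0 x = 1 + pbar * age_gain 0 x.+1 + (1 - pbar) * age_gain 0 0.
Proof.
have /andP[p0 p1] := pbar01.
rewrite /= expr0 exprS; field.
by rewrite expf_neq0 ?subr_eq0 ?gt_eqF.
Qed.

Lemma age_gainE i x : age_gain (I - i) x =
  1 + p i * age_gain (I - i.+1) x.+1 + (1 - p i) * age_gain (I - i.+1) 0.
Proof.
(* Truncated subtraction makes [I - i] vanish from cell [I] on, where the stationary equation takes
   over. *)
case: (ltnP i I) => iI.
  have -> : (I - i = (I - i.+1).+1)%N by lia.
  by rewrite [LHS]/=; have -> : (I - (I - i.+1).+1 = i)%N by lia.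
have -> : (I - i = 0)%N by lia.
have -> : (I - i.+1 = 0)%N by lia.
by rewrite p_late // -age_gain_late.
Qed.

Lemma value_step ks i s : all (fun k => (I <= k)%N) ks -> admissible ks i s ->
  value i s = (busy s)%:R +
    (p i * value i.+1 (step true s) + (1 - p i) * value i.+1 (step false s)).
Proof.
move=> hks0; case: s => x [|k ks'] [/= xi sk hx].
  by rewrite /value /= !mulr0 !addr0.
have xk := hx _ _ erefl; have := suffix_all_ge sk hks0 => /= /andP[Ik hks].
have -> : value i.+1 (step true (x, k :: ks')) =
    \sum_(k <- k :: ks') run_cost k + age_gain (I - i.+1) x.+1.
  rewrite /step /=; case: ifP => xk1 //.
  (* Completion: [x <= i] and [I <= k = x.+1] give [I <= i.+1], so the age term is the stationary
     one and cancels the finished task. *)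
  have ek : x.+1 = k by lia.
  have -> : (I - i.+1 = 0)%N by lia.
  rewrite big_cons ek addrAC age_gain_cost add0r /value /busy /=.
  have -> : (I - i.+1 = 0)%N by lia.
  case: ks' {hks sk hx} => [|k' ks'] /=; first by rewrite big_nil.
  by rewrite expr0 invr1 subrr mul0r addr0.
rewrite /value /step /busy /= (age_gainE i x); ring.
Qed.

Lemma Ev_value_step ks i : all (fun k => (I <= k)%N) ks ->
  Ev ks i (value i) = Ev ks i (fun s => (busy s)%:R) + Ev ks i.+1 (value i.+1).
Proof.
by move=> hks; rewrite /= -EvD; apply: Ev_ext_admissible => // s; exact: (value_step hks).
Qed.

Lemma sum_Ev_busy ks H : all (fun k => (I <= k)%N) ks ->
  \sum_(i < H) Ev ks i (fun s => (busy s)%:R) =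
  value 0 (0%N, ks) - Ev ks H (value H).
Proof.
move=> hks; elim: H => [|H IH]; first by rewrite big_ord0 /= subrr.
rewrite big_ord_recr /= IH (Ev_value_step _ hks) /=; ring.
Qed.

Lemma run_cost_ge0 k : 0 <= run_cost k.
Proof.
have /andP[p0 p1] := pbar01.
apply: divr_ge0; rewrite subr_ge0; last exact: ltW.
by rewrite -exprVn exprn_ege1 // invf_ge1 // ltW.
Qed.

Lemma age_gain0_le0 x : age_gain 0 x <= 0.
Proof. by rewrite -(age_gain_cost x) lerDr run_cost_ge0. Qed.

Lemma run_cost_mono j k : (j <= k)%N -> run_cost j <= run_cost k.
Proof.
move=> jk; have /andP[p0 p1] := pbar01.
apply: ler_wpM2r; first by rewrite invr_ge0 subr_ge0 ltW.
by rewrite lerD2r -!exprVn ler_weXn2l // invf_ge1 // ltW.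
Qed.

(** Past cell [I] the age correction is [- run_cost x] with [x] below the current requirement: it is
    nonpositive and cannot outweigh the cost of the current task. *)
Lemma value_bounds ks i s : (I <= i)%N -> admissible ks i s ->
  0 <= value i s <= (\sum_(k <- ks) run_cost k) * (busy s)%:R.
Proof.
move=> Ii; case: s => x [|k ks'] [/= xi sk hx].
  by rewrite /value /= mulr0 lexx.
rewrite /value /busy [_ != _]/= mulr1 /=.
have -> : (I - i = 0)%N by lia.
have rs_ge0 l : 0 <= \sum_(k <- l) run_cost k.
  by apply: sumr_ge0 => ? _; exact: run_cost_ge0.
apply/andP; split.
  rewrite big_cons addrAC addr_ge0 //.
  have := age_gain_cost x; have := run_cost_mono (ltnW (hx _ _ erefl)).
  rewrite [age_gain 0 x]/=; lra.
move/suffixP: sk => [l ->]; rewrite big_cat /=.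
apply: (@le_trans _ _ (\sum_(k <- k :: ks') run_cost k)); last by rewrite lerDr.
by rewrite gerDl age_gain0_le0.
Qed.

Lemma Ev_busy_noninc ks i : all (fun k => (I <= k)%N) ks ->
  Ev ks i.+1 (fun s => (busy s)%:R) <= Ev ks i (fun s => (busy s)%:R).
Proof.
move=> hks /=; apply: Ev_le_admissible => // s _.
have /andP[p0 p1] := p01 i.
have h b : (busy (step b s))%:R <= (busy s)%:R :> R.
  by rewrite ler_nat; have := @busy_step b s; do 2!case: busy => //; move/(_ isT).
have := ler_wpM2l p0 (h true).
have := ler_wpM2l (_ : 0 <= 1 - p i) (h false); rewrite subr_ge0 => /(_ p1).
lra.
Qed.

(** By telescoping, the missing part of the sum is the expected value at cell [H], at most a
    constant times the probability of being busy there. That probability never increases and has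
    bounded sums, so it is [O(1 / H)]. *)
Lemma sum_Ev_busy_bounds ks H : all (fun k => (I <= k)%N) ks -> (I <= H)%N ->
  \sum_(i < H) Ev ks i (fun s => (busy s)%:R) <= value 0 (0%N, ks) /\
  H%:R * (value 0 (0%N, ks) - \sum_(i < H) Ev ks i (fun s => (busy s)%:R)) <=
    (\sum_(k <- ks) run_cost k) * value 0 (0%N, ks).
Proof.
move=> hks IH; set S := \sum_(i < H) _; set K := \sum_(k <- ks) _.
have K0 : 0 <= K by apply: sumr_ge0 => ? _; exact: run_cost_ge0.
have eS : value 0 (0%N, ks) = S + Ev ks H (value H) by rewrite /S sum_Ev_busy // subrK.
have SU : S <= value 0 (0%N, ks).
  have z : Ev ks H (fun=> 0) = 0.
    by rewrite -[RHS](mul0r (Ev ks H (fun=> 0))) -EvZ mul0r.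
  rewrite eS lerDl -z; apply: Ev_le_admissible => // s hs.
  by have /andP[] := value_bounds IH hs.
split => //; rewrite {1}eS addrAC subrr add0r.
have h1 : Ev ks H (value H) <= K * Ev ks H (fun s => (busy s)%:R).
  rewrite -EvZ; apply: Ev_le_admissible => // s hs.
  by have /andP[] := value_bounds IH hs.
(* [H] times the term at [H] lies below the sum of the earlier terms, since the terms never
   increase. *)
have h2 : H%:R * Ev ks H (fun s => (busy s)%:R) <= S.
  rewrite mulrC -[X in _ * X%:R](card_ord H) mulr_natr -sumr_const.
  apply: ler_sum => -[i /= /ltnW iH] _; rewrite -{1}(subnKC iH).
  elim: (H - i)%N => [|m IHm]; first by rewrite addn0.
  by rewrite addnS (le_trans (Ev_busy_noninc _ hks)).
apply: le_trans (ler_wpM2l (ler0n _ _) h1) _.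
rewrite mulrCA ler_wpM2l //; exact: le_trans h2 SU.
Qed.

End DiscreteMachine.

(** * Completion times along a single path *)

Section Paths.
Variables (R : realType) (n : R -> nat).
Hypothesis n_mono : forall s t, 0 <= s -> s <= t -> (n s <= n t)%N.
Hypothesis n_rcont : forall t, 0 <= t ->
  exists2 e, 0 < e & forall u, t <= u -> u < t + e -> n u = n t.

Lemma task_end_ge c s : 0 <= c -> (s%:E <= task_end c s n)%E.
Proof.
move=> c0; apply: le_ereal_inf_tmp => _ [r [[->|[sr _]] _] <-]; rewrite lee_fin.
  by rewrite lerDl.
by rewrite (le_trans (ltW sr)) // lerDl.
Qed.

(* The last restart point before [r] is [s] or the infimum of the times at
   which the counter already has the value [n r]; right continuity makes the
   infimum attained. *)
Lemma exists_last_restart s r : 0 <= s -> s <= r ->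
  exists2 q, s <= q <= r & restart_pt n s q /\ n q = n r.
Proof.
move=> s0 sr.
pose A := [set u | s <= u <= r /\ n u = n r].
have Ar : A r by split => //; rewrite sr lexx.
have lA : lbound A s by move=> u [/andP[]].
have iA : has_inf A by split; [exists r | exists s].
have sq : s <= inf A by apply: lb_le_inf => //; exists r.
have qr : inf A <= r by apply: ge_inf => //; exists s.
have nq : n (inf A) = n r.
  have [e e0 he] := n_rcont (le_trans s0 sq).
  have [u [/andP[su ur] nu] ue] := inf_adherent e0 iA.
  by rewrite -nu he // ge_inf //; [exists s | split => //; rewrite su ur].
exists (inf A); first by rewrite sq qr.
split => //; move: sq; rewrite le_eqVlt => /predU1P[<-|sq]; first by left.
right; split => // u su uq.
rewrite ltn_neqAle (n_mono (le_trans s0 su) (ltW uq)) andbT.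
apply/eqP => nu.
have : inf A <= u.
  apply: ge_inf; first by exists s.
  by split; [rewrite su (le_trans (ltW uq)) | rewrite nu].
by rewrite leNgt uq.
Qed.

(** The last restart point up to [r] has the same counter value as [r], so the clean stretch reaches
    back to it, and starting there only ends earlier. *)
Lemma task_end_le c s r : 0 <= s -> s <= r -> n r = n (r + c) -> 0 <= c ->
  (task_end c s n <= (r + c)%:E)%E.
Proof.
move=> s0 sr nr c0; have [q /andP[sq qr] [hq nq]] := exists_last_restart s0 sr.
apply: (@le_trans _ _ (q + c)%:E); last by rewrite lee_fin lerD2r.
apply: ereal_inf_lbound; exists q => //; split => // u qu ur.
have q0 := le_trans s0 sq.
apply/eqP; rewrite eqn_leq (n_mono q0 qu) andbT nq nr.
apply: n_mono; first exact: le_trans qu.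
by rewrite (le_trans (ltW ur)) // lerD2r.
Qed.

Lemma task_end_fin c s r : 0 <= s -> s <= r -> n r = n (r + c) -> 0 <= c ->
  exists2 s', task_end c s n = s'%:E & s <= s' <= r + c.
Proof.
move=> s0 sr nr c0; have h1 := task_end_le s0 sr nr c0.
have h2 := @task_end_ge c s c0.
case: (task_end c s n) h1 h2 => [s'| |] //; rewrite !lee_fin => h1 h2.
by exists s' => //; rewrite h1 h2.
Qed.

Lemma seq_end_cons c cs s :
  seq_end (c :: cs) s n =
  if task_end c s n is s'%:E then seq_end cs s' n else task_end c s n.
Proof.
rewrite /seq_end /=; case: (task_end c s n) => [r| |] //.
  by elim: cs => // ? ? IH.
by elim: cs => // ? ? IH.
Qed.

Lemma seq_end_ge cs s : all (fun c => 0 <= c) cs -> (s%:E <= seq_end cs s n)%E.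
Proof.
elim: cs s => [|c cs IH] s //= /andP[c0 cs0]; rewrite seq_end_cons.
have := @task_end_ge c s c0; case: task_end => // s' ss'.
exact: le_trans (IH _ cs0).
Qed.

(** * Comparison of a path with the machine reading its cells *)

Variable (dl : R).
Hypothesis dl_gt0 : 0 < dl.

Lemma grid_mono (i j : nat) : (i <= j)%N -> i%:R * dl <= j%:R * dl.
Proof. by move=> ij; rewrite ler_wpM2r ?ler_nat // ltW. Qed.

Definition bit (i : nat) : bool := n (i.+1%:R * dl) == n (i%:R * dl).

(** Follows [i] while tasks remain, then stays frozen at the machine's completion. *)
Definition work (ks : seq nat) (i : nat) : nat :=
  \sum_(j < i) busy (run bit ks j).

Lemma work_le ks i : (work ks i <= i)%N.
Proof.
by rewrite -[X in (_ <= X)%N]card_ord -sum1_card; apply: leq_sum => j _; case: busy.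
Qed.

Lemma work_busy ks i : busy (run bit ks i) -> work ks i = i.
Proof.
elim: i => [|i IH] h; first by rewrite /work big_ord0.
have hi : busy (run bit ks i) := busy_step h.
by rewrite /work big_ord_recr /= -/(work ks i) (IH hi) hi addn1.
Qed.

Lemma path_upper_inv (k : R -> nat) cs i :
  all (fun c => 0 <= c) cs -> (forall c, c \in cs -> c <= (k c)%:R * dl) ->
  exists rest s, [/\ run bit (map k cs) i = ((run bit (map k cs) i).1, map k rest),
    seq_end cs 0 n = seq_end rest s n, 0 <= s, subseq rest cs &
    let x := (run bit (map k cs) i).1 in
    let m := work (map k cs) i in
    [/\ (x <= m)%N, s <= (m - x)%:R * dl & n ((m - x)%:R * dl) = n (m%:R * dl)]].
Proof.
move=> cs0 hk; elim: i => [|i [rest [s [er es s0 sub [xm sm nm]]]]].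
  by exists cs, 0; rewrite /= /work big_ord0 /= subnn mul0r.
set ks := map k cs in er es xm sm nm *.
have wS : work ks i.+1 = (work ks i + busy (run bit ks i))%N.
  by rewrite /work big_ord_recr.
move: er xm sm nm; set x := (run bit ks i).1 => er xm sm nm.
case: rest er es sub => [|c rest] er es sub.
  have -> : run bit ks i.+1 = (0%N, [::]) by rewrite /= er.
  exists [::], s; split => //=; rewrite wS er /= addn0 subn0; split => //.
  by rewrite (le_trans sm) // grid_mono ?leq_subr //.
have bi : busy (run bit ks i) by rewrite er.
rewrite wS bi addn1; have wi := work_busy bi; rewrite wi in xm sm nm *.
have cin : c \in cs by apply: (mem_subseq sub); rewrite mem_head.
have c0 : 0 <= c by move/allP: cs0 => /(_ _ cin).
have ck := hk _ cin.
rewrite [run bit ks i.+1]/= er /step /=.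
case: ifP => [bt|_]; last first.
  exists (c :: rest), s; split => //=; rewrite subn0; split => //.
  by rewrite (le_trans sm) // grid_mono ?leqW ?leq_subr.
have nm1 : n ((i - x)%:R * dl) = n (i.+1%:R * dl).
  by rewrite nm; apply/esym/eqP.
case: ifP => xk /=.
  by exists (c :: rest), s; split => //=; rewrite subSS; split.
(* The streak has reached [k c] cells, so a clean interval of length [c] fits between its start and
   the end of cell [i]. *)
have tc : (i - x)%:R * dl + c <= i.+1%:R * dl.
  apply: le_trans (_ : (i - x)%:R * dl + (k c)%:R * dl <= _).
    by rewrite lerD2l.
  rewrite -mulrDl -natrD grid_mono //; clear -xm xk; lia.
have p0 : 0 <= (i - x)%:R * dl by rewrite mulr_ge0 // ltW.
have ntc : n ((i - x)%:R * dl) = n ((i - x)%:R * dl + c).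
  apply/eqP; rewrite eqn_leq n_mono ?lerDl //= nm1.
  by apply: n_mono => //; rewrite addr_ge0.
have [s' es' /andP[ss' s'r]] := task_end_fin s0 sm ntc c0.
exists rest, s'; split => //=.
- by rewrite es seq_end_cons es'.
- exact: le_trans ss'.
- exact: subseq_trans (subseq_cons _ _) sub.
by rewrite subn0; split => //; exact: le_trans tc.
Qed.

(** If the machine finishes, the partial sum at that cell already bounds the completion time; if it
    never does, the series diverges. *)
Lemma path_upper (k : R -> nat) cs :
  all (fun c => 0 <= c) cs -> (forall c, c \in cs -> c <= (k c)%:R * dl) ->
  (seq_end cs 0 n <=
   \sum_(0 <= i <oo) (dl * (busy (run bit (map k cs) i))%:R)%:E)%E.
Proof.
move=> cs0 hk; set ks := map k cs.
have t0 i : (0 <= (dl * (busy (run bit ks i))%:R)%:E)%E.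
  by rewrite lee_fin mulr_ge0 // ltW.
have ps H : \sum_(0 <= i < H) (dl * (busy (run bit ks i))%:R)%:E =
    ((work ks H)%:R * dl)%:E.
  by rewrite sumEFin big_mkord -mulr_sumr mulrC -natr_sum.
have le_s H : (((work ks H)%:R * dl)%:E <=
    \sum_(0 <= i <oo) (dl * (busy (run bit ks i))%:R)%:E)%E.
  by rewrite -ps; apply: nneseries_lim_ge.
have [[H nb]|allb] := pselect (exists H, ~~ busy (run bit ks H)).
  have [rest [s [er es s0 _ [_ sm _]]]] := path_upper_inv H cs0 hk.
  have e0 : rest = [::] by move: nb; rewrite -/ks er; case: (rest).
  rewrite es e0; apply: le_trans (le_s H).
  rewrite lee_fin (le_trans sm) // grid_mono ?leq_subr //.
apply: (le_trans (leey _)); rewrite leye_eq; apply/eqP/eqyP => A A0.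
have /ltW/le_trans := archi_boundP (ltW (divr_gt0 A0 dl_gt0)).
move/(_ _ (lexx _)) => hA.
apply: le_trans (le_s (Num.bound (A / dl))).
rewrite work_busy; last by apply: contrapT => /negP h; apply: allb; eexists; exact: h.
by rewrite lee_fin -ler_pdivrMr.
Qed.

Lemma not_disr_bits r c i : 0 <= r -> no_disr n r c -> r <= i%:R * dl ->
  i.+1%:R * dl < r + c -> bit i.
Proof.
move=> r0 nd ri ic; apply/eqP.
have d : i%:R * dl <= i.+1%:R * dl by rewrite grid_mono.
by rewrite nd ?(le_trans ri) // (nd (i%:R * dl)) // (le_lt_trans d).
Qed.

(* No [k] consecutive bits starting at [j] or later are set before [i]. *)
Definition no_window (k j i : nat) : Prop := forall i0, (j <= i0)%N ->
  (i0 + k <= i)%N -> exists2 b, (i0 <= b < i0 + k)%N & ~~ bit b.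

(** Two spare cells: one is lost in rounding the start [r] up to the grid, the other keeps the
    window of [k] cells strictly inside the half-open clean interval. *)
Lemma task_end_ge_no_window c s j i k : 0 <= s -> 0 <= c -> j%:R * dl <= s ->
  no_window k j i -> k.+2%:R * dl <= c ->
  ((i.+1%:R * dl)%:E <= task_end c s n)%E.
Proof.
move=> s0 c0 js hw kc; apply: le_ereal_inf_tmp => _ [r [hr nd] <-].
rewrite lee_fin leNgt; apply/negP => ri.
have sr : s <= r by case: hr => [->|[/ltW]].
have r0 := le_trans s0 sr.
pose m := Num.truncn (r / dl).
have rd0 : 0 <= r / dl by rewrite divr_ge0 // ltW.
have /andP[m1 m2] := truncn_itv rd0.
have mr : m%:R * dl <= r by rewrite -ler_pdivlMr.
have rm : r < m.+1%:R * dl by rewrite -ltr_pdivrMr.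
have jm : (j <= m)%N.
  rewrite leqNgt; apply/negP => mj.
  have : m.+1%:R * dl <= j%:R * dl by rewrite grid_mono.
  by rewrite leNgt (le_lt_trans (le_trans js sr)).
have mki : (m + k.+2 < i.+1)%N.
  rewrite -(ltr_nat R) -(ltr_pM2r dl_gt0) natrD mulrDl.
  by apply: le_lt_trans ri; rewrite lerD.
have [||b /andP[b1 b2] /negP[]] := hw m.+1; first exact: leqW.
  by clear -mki; lia.
apply: (@not_disr_bits r c) => //.
  by rewrite (le_trans (ltW rm)) // grid_mono.
have : (b.+1 < m + k.+2)%N by clear -b2; lia.
rewrite -(ltr_nat R) -(ltr_pM2r dl_gt0) natrD => /lt_le_trans; apply.
by rewrite mulrDl lerD.
Qed.

(** With requirements rounded down, the real system is never ahead: the machine took up the current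
    task at cell [j], and its real start is no earlier. The last clause says that the age covers any
    clean streak since [j] still running at [i]. *)
Lemma path_lower_inv (k : R -> nat) cs i :
  all (fun c => 0 <= c) cs ->
  (forall c, c \in cs -> (0 < k c)%N /\ (k c).+2%:R * dl <= c) ->
  seq_end cs 0 n = +oo%E \/
  exists rest s, [/\ run bit (map k cs) i = ((run bit (map k cs) i).1, map k rest),
    seq_end cs 0 n = seq_end rest s n, 0 <= s, subseq rest cs &
    if rest is c :: _ then
      exists j, [/\ j%:R * dl <= s, (j <= i)%N, no_window (k c) j i,
        ((run bit (map k cs) i).1 < k c)%N &
        forall i0, (j <= i0 <= i)%N -> (forall b, (i0 <= b < i)%N -> bit b) ->
          (i - i0 <= (run bit (map k cs) i).1)%N]
    else (work (map k cs) i)%:R * dl <= s].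
Proof.
move=> cs0 hk; set ks := map k cs; elim: i => [|i [->|IH]]; [|by left|].
  right; exists cs, 0; split => //.
  case: (cs) hk => [|c cs'] hk; first by rewrite /work big_ord0 mul0r.
  have [k0 _] := hk _ (mem_head _ _).
  exists 0%N; split => //=; rewrite ?mul0r // => i0 _; clear -k0; lia.
case: IH => rest [s [er es s0 sub H]].
have wS : work ks i.+1 = (work ks i + busy (run bit ks i))%N.
  by rewrite /work big_ord_recr.
move: er H; set x := (run bit ks i).1 => er H.
case: rest er es sub H => [|c rest] er es sub H.
  right; have -> : run bit ks i.+1 = (0%N, [::]) by rewrite /= er.
  by exists [::], s; split => //=; rewrite wS er /= addn0.
have bi : busy (run bit ks i) by rewrite er.
have cin : c \in cs by apply: (mem_subseq sub); rewrite mem_head.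
have [k0 kc] := hk _ cin.
have c0 : 0 <= c by move/allP: cs0 => /(_ _ cin).
have [j [js ji hw xk age]] := H.
rewrite [run bit ks i.+1]/= er /step /=.
(* A new window would have to end with cell [i]; its bits would force the age [k c - 1], that is,
   the excluded completion. *)
have hw1 : ~~ (bit i && (x.+1 == k c)) -> no_window (k c) j i.+1.
  move=> hx i0 ji0 i0i; have [lt|ge] := leqP (i0 + k c) i; first exact: hw.
  have [bt|nb] := boolP (bit i); last first.
    by exists i => //; clear -ge i0i k0; lia.
  apply: contrapT => nb.
  have : (i - i0 <= x)%N.
    apply: age; first by clear -ji0 i0i ge k0 xk; lia.
    move=> b bi0; apply: contrapT => /negP nbb; apply: nb; exists b => //.
    by clear -bi0 ge; lia.
  move: hx; rewrite bt /= => /eqP; clear -xk ge i0i; lia.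
case: ifP => bt; last first.
  right; exists (c :: rest), s; split => //=; exists j; split => //.
  - exact: leqW.
  - by apply: hw1; rewrite bt.
  - move=> i0 /andP[ji0]; rewrite leq_eqVlt => /predU1P[-> _|]; first by rewrite subnn.
    by rewrite ltnS => i0i /(_ i); rewrite bt i0i ltnSn => /(_ isT).
case: ifP => xk1.
  right; exists (c :: rest), s; split => //=; exists j; split => //.
  - exact: leqW.
  - by apply: hw1; rewrite bt /= neq_ltn xk1.
  - move=> i0 /andP[ji0]; rewrite leq_eqVlt => /predU1P[-> _|]; first by rewrite subnn.
    rewrite ltnS => i0i hb; rewrite subSn // ltnS; apply: age; first by rewrite ji0.
    by move=> b /andP[b1 b2]; apply: hb; rewrite b1 (leqW b2).
(* The machine completes the task in cell [i]; having no window up to [i] keeps the real completion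
   at or after the end of that cell. *)
have := task_end_ge_no_window s0 c0 js hw kc.
have := @task_end_ge c s c0; rewrite es seq_end_cons.
case: (task_end c s n) => [s'| |] // ; last by left.
rewrite !lee_fin => ss' is'; right; exists rest, s'; split => //=.
- exact: le_trans ss'.
- exact: subseq_trans (subseq_cons _ _) sub.
case: rest {er es H} sub => [|c' rest] sub.
  by rewrite wS bi addn1 (work_busy bi).
have [] := hk c'; first by apply: (mem_subseq sub); rewrite !inE eqxx orbT.
move=> k'0 _; exists i.+1; split => //.
- by move=> i0 i1; clear -k'0 i1; lia.
- by move=> i0 i0i _; clear -i0i; lia.
Qed.

Lemma path_lower (k : R -> nat) cs H :
  all (fun c => 0 <= c) cs ->
  (forall c, c \in cs -> (0 < k c)%N /\ (k c).+2%:R * dl <= c) ->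
  ((\sum_(i < H) dl * (busy (run bit (map k cs) i))%:R)%:E <= seq_end cs 0 n)%E.
Proof.
move=> cs0 hk; set ks := map k cs.
have -> : \sum_(i < H) dl * (busy (run bit ks i))%:R = (work ks H)%:R * dl.
  by rewrite -mulr_sumr mulrC -natr_sum.
have [->|[rest [s [er es s0 sub]]]] := path_lower_inv H cs0 hk; first exact: leey.
have r0 : all (fun c => 0 <= c) rest.
  by apply/allP => c /(mem_subseq sub); exact: (allP cs0).
rewrite es; case: rest {er es} sub r0 => [|c rest] sub r0.
  by move=> ws; rewrite lee_fin.
case=> j [js jH hw _ _]; move: r0 => /= /andP[c0 r0]; rewrite seq_end_cons.
have [k0 kc] := hk c (mem_subseq sub (mem_head _ _)).
have := task_end_ge_no_window s0 c0 js hw kc.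
have wl : (work ks H)%:R * dl <= H.+1%:R * dl.
  by rewrite grid_mono // leqW // work_le.
case: task_end => // [s'|_]; last exact: leey.
rewrite lee_fin => hs'; apply: le_trans (@seq_end_ge _ _ r0).
by rewrite lee_fin (le_trans wl).
Qed.

End Paths.

(** * From independent increments to the law of the machine *)

Section IndependentBits.
Variables (R : realType) (d : measure_display) (T : measurableType d).
Variables (P : probability T R) (X : nat -> T -> nat).
Hypothesis mX : forall i S, measurable (X i @^-1` S).
Hypothesis indepX : forall m (ks : nat -> nat),
  P (\big[setI/setT]_(i < m) X i @^-1` [set ks i]) =
  (\prod_(i < m) P (X i @^-1` [set ks i]))%E.

Definition cylinder (m : nat) (B : nat -> set nat) : set T :=
  \big[setI/setT]_(i < m) X i @^-1` B i.

Lemma measurable_cylinder m B : measurable (cylinder m B).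
Proof. by apply: bigsetI_measurable => i _; exact: mX. Qed.

Lemma measure_level_sum D j B : measurable D ->
  P (X j @^-1` B `&` D) =
  (\sum_(0 <= k <oo) P (X j @^-1` (B `&` [set k]) `&` D))%E.
Proof.
move=> mD.
have -> : X j @^-1` B `&` D = \bigcup_k (X j @^-1` (B `&` [set k]) `&` D).
  apply/seteqP; split => [w [Bw Dw]|w [k _ [[Bw _] Dw]]] //.
  by exists (X j w).
rewrite measure_semi_bigcup //.
- by move=> k; apply: measurableI.
- by move=> k l _ _ [w [[[_ /= <-] _] [[_ /= <-] _]]].
- by apply: bigcup_measurable => k _; apply: measurableI.
Qed.

(** Frees one coordinate: the product rule with singletons at [j] is summed over the values of [X j]
    by countable additivity. *)
Lemma cylinder_prob_step m j B : 
  (forall S, (exists k, S = [set k]) ->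
     P (cylinder m (fun i => if i == j then S else B i)) =
     (\prod_(i < m) P (X i @^-1` (if val i == j then S else B i)))%E) ->
  P (cylinder m B) = (\prod_(i < m) P (X i @^-1` B i))%E.
Proof.
move=> h; have [mj|jm] := leqP m j.
  (* Coordinate [j] lies outside the cylinder, so any singleton serves as a placeholder. *)
  have e (i : 'I_m) : (if val i == j then [set 0%N] else B i) = B i.
    by rewrite ltn_eqF // (leq_trans (ltn_ord i)).
  under eq_bigr do rewrite -e.
  rewrite -h; last by exists 0%N.
  by congr (P _); apply: eq_bigr => i _; rewrite -[LHS](congr1 _ (e i)).
pose D := \big[setI/setT]_(i < m | i != Ordinal jm) X i @^-1` B i.
pose q := (\prod_(i < m | i != Ordinal jm) P (X i @^-1` B i))%E.
have mD : measurable D by apply: bigsetI_measurable => i _; exact: mX.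
have eC S : cylinder m (fun i => if i == j then S else B i) = X j @^-1` S `&` D.
  rewrite /cylinder (bigD1 (Ordinal jm)) //= eqxx; congr (_ `&` _).
  by apply: eq_bigr => i ij; rewrite (negbTE (ij : val i != j)).
have eQ S : (\prod_(i < m) P (X i @^-1` (if val i == j then S else B i)) =
    P (X j @^-1` S) * q)%E.
  rewrite (bigD1 (Ordinal jm)) //= eqxx; congr (_ * _)%E.
  by apply: eq_bigr => i ij; rewrite (negbTE (ij : val i != j)).
have hS S : (exists k, S = [set k]) -> P (X j @^-1` S `&` D) = (P (X j @^-1` S) * q)%E.
  by move=> /h; rewrite eC eQ.
have -> : cylinder m B = X j @^-1` B j `&` D.
  by rewrite /cylinder (bigD1 (Ordinal jm)).
rewrite (bigD1 (Ordinal jm)) //= -/q measure_level_sum //.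
have q0 : (0 <= q)%E by apply: prode_ge0 => i _.
have qf : q \is a fin_num.
  by apply: prode_fin_num => i _; exact: fin_num_measure.
have -> : P (X j @^-1` B j) = (\sum_(0 <= k <oo) P (X j @^-1` (B j `&` [set k])))%E.
  rewrite -[X in P X]setIT measure_level_sum //.
  by apply: eq_eseriesr => k _; rewrite setIT.
rewrite muleC -(fineK qf) -nneseriesZl //.
apply: eq_eseriesr => k _; rewrite fineK // muleC.
have [Bk|nBk] := pselect (B j k).
  have -> : B j `&` [set k] = [set k] by apply/seteqP; split => [l []|l ->].
  by apply: hS; exists k.
have -> : B j `&` [set k] = set0 by apply/seteqP; split => [l [+ e]|l //]; rewrite e.
by rewrite preimage_set0 set0I measure0 mul0e.
Qed.

(** Independence is given for point values; the induction frees the coordinates one by one, the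
    first [j] sets being arbitrary and the others singletons. *)
Lemma cylinder_prob m B : P (cylinder m B) = (\prod_(i < m) P (X i @^-1` B i))%E.
Proof.
suff H j : forall B, (forall i, (j <= i)%N -> exists k, B i = [set k]) ->
    P (cylinder m B) = (\prod_(i < m) P (X i @^-1` B i))%E.
  pose B' i := if (i < m)%N then B i else [set 0%N].
  have e (i : 'I_m) : B' i = B i by rewrite /B' ltn_ord.
  have <- : cylinder m B' = cylinder m B by apply: eq_bigr => i _; rewrite e.
  rewrite (H m B'); first by apply: eq_bigr => i _; rewrite e.
  by move=> i mi; exists 0%N; rewrite /B' ltnNge mi.
elim: j => [|j IH] {}B hB.
  have /choice[ks hks] i : exists k, B i = [set k] by exact: hB.
  have -> : B = (fun i => [set ks i]) by apply/funext.
  exact: indepX.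
apply: (@cylinder_prob_step _ j) => S hS.
apply: IH => i; rewrite leq_eqVlt => /predU1P[<-|ji]; first by rewrite eqxx.
by rewrite gtn_eqF //; exact: hB.
Qed.

Definition bits (w : T) (i : nat) : bool := X i w == 0%N.

Definition bit_prob (i : nat) : R := fine (P (X i @^-1` [set 0%N])).

Lemma measurable_run ks i (Y : set state) :
  measurable [set w | Y (run (bits w) ks i)].
Proof.
elim: i Y => [|i IH] Y /=.
  have [y|y] := pselect (Y (0%N, ks)).
    by rewrite (_ : [set _ | _] = setT) //; apply/seteqP; split.
  by rewrite (_ : [set _ | _] = set0) //; apply/seteqP; split.
have -> : [set w | Y (step (bits w i) (run (bits w) ks i))] =
    (X i @^-1` [set 0%N] `&` [set w | (Y \o step true) (run (bits w) ks i)]) `|`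
    (X i @^-1` (~` [set 0%N]) `&` [set w | (Y \o step false) (run (bits w) ks i)]).
  apply/seteqP; split => w; rewrite /bits /=.
    by case: eqP => h y; [left|right].
  by case=> -[h y]; case: eqP.
by apply: measurableU; apply: measurableI => //; exact: IH.
Qed.

Lemma measurable_fun_run ks i (g : state -> R) (D : set T) :
  measurable_fun D (EFin \o (fun w => g (run (bits w) ks i))).
Proof.
move=> mD Y mY; apply: measurableI => //.
exact: (measurable_run ks i (fun s => Y (g s)%:E)).
Qed.

Lemma bit_prob_itv i : 0 <= bit_prob i <= 1.
Proof.
rewrite /bit_prob fine_ge0 //= -[1]/(fine 1%:E) fine_le ?fin_num_measure //.
exact: probability_le1.
Qed.

Lemma prob_bitC i : P (X i @^-1` (~` [set 0%N])) = (1 - bit_prob i)%:E.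
Proof.
rewrite -preimage_setC probability_setC // EFinB fineK //; exact: fin_num_measure.
Qed.

(* The cylinder constrains only increments not yet read by the machine, so it
   factors out; this is what makes the induction on [i] go through. *)
Lemma integral_run_cylinder ks i m B (g : state -> R) :
  (i <= m)%N -> (forall l, (l < i)%N -> B l = setT) -> (forall s, 0 <= g s) ->
  (\int[P]_(w in cylinder m B) (g (run (bits w) ks i))%:E =
   (Ev bit_prob ks i g)%:E * P (cylinder m B))%E.
Proof.
elim: i B g => [|i IH] B g im hB g0 /=.
  by rewrite integral_cst //; exact: measurable_cylinder.
(* [upd S] records the bit read last as a constraint on coordinate [i], which the induction
   hypothesis allows. *)
pose upd S l := if l == i then S else B l.
have cU S : cylinder m (upd S) = X i @^-1` S `&` cylinder m B.
  rewrite /cylinder (bigD1 (Ordinal im)) //= [in RHS](bigD1 (Ordinal im)) //=.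
  rewrite hB // preimage_setT setTI /upd eqxx; congr (_ `&` _).
  by apply: eq_bigr => l li; rewrite (negbTE (li : val l != i)).
have pU S : P (cylinder m (upd S)) = (P (X i @^-1` S) * P (cylinder m B))%E.
  rewrite !cylinder_prob (bigD1 (Ordinal im)) //= [in RHS](bigD1 (Ordinal im)) //=.
  rewrite hB // preimage_setT probability_setT mul1e /upd eqxx; congr (_ * _)%E.
  by apply: eq_bigr => l li; rewrite (negbTE (li : val l != i)).
have eC : cylinder m B = cylinder m (upd [set 0%N]) `|` cylinder m (upd (~` [set 0%N])).
  by rewrite !cU -setIUl -preimage_setU setUv preimage_setT setTI.
have branch b S : (forall w, S (X i w) -> bits w i = b) ->
    (\int[P]_(w in cylinder m (upd S)) (g (step (bits w i) (run (bits w) ks i)))%:E =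
     (Ev bit_prob ks i (g \o step b))%:E * (P (X i @^-1` S) * P (cylinder m B)))%E.
  move=> hS; rewrite -pU -IH; first 1 last.
  - exact: ltnW.
  - by move=> l li; rewrite /upd ltn_eqF // hB // ltnW.
  - by move=> s; exact: g0.
  apply: eq_integral => w; rewrite inE cU => -[/hS -> _] //.
rewrite [X in (\int[P]_(w in X) _)%E]eC ge0_integral_setU; first last.
- apply/disj_setPS => w; rewrite !cU => -[[h _] [h' _]]; exact: h'.
- by move=> w _; rewrite lee_fin.
- exact: (measurable_fun_run ks i.+1).
- exact: measurable_cylinder.
- exact: measurable_cylinder.
rewrite (branch true) ?(branch false); first last.
- by move=> w /eqP.
- by move=> w /eqP/negbTE.
rewrite prob_bitC.
have -> : P (X i @^-1` [set 0%N]) = (bit_prob i)%:E.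
  by rewrite fineK //; exact: fin_num_measure.
rewrite EvD !EvZ /=.
have cf : P (cylinder m B) \is a fin_num.
  by apply: fin_num_measure; exact: measurable_cylinder.
rewrite -(fineK cf) -!EFinM -EFinD; congr EFin; rewrite /comp; ring.
Qed.

Lemma integral_run ks i (g : state -> R) : (forall s, 0 <= g s) ->
  (\int[P]_w (g (run (bits w) ks i))%:E = (Ev bit_prob ks i g)%:E)%E.
Proof.
move=> g0; have := @integral_run_cylinder ks i i (fun=> setT) g (leqnn _) _ g0.
have -> : cylinder i (fun=> setT) = setT by rewrite /cylinder big1.
by rewrite probability_setT mule1; apply.
Qed.

End IndependentBits.

(** * Comparing integrals and passing to the limit *)

(* No measurability is needed: a nonnegative integral is a supremum over the
   simple functions below the integrand. *)
Lemma ge0_le_integral_nonmeasurable (R : realType) (d : measure_display)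
    (T : measurableType d) (mu : {measure set T -> \bar R}) (f g : T -> \bar R) :
  (forall x, 0 <= f x)%E -> (forall x, f x <= g x)%E ->
  (\int[mu]_x f x <= \int[mu]_x g x)%E.
Proof.
move=> f0 fg; rewrite !ge0_integralTE //; last by move=> x; exact: le_trans (fg x).
apply: ereal_sup_le => _ [h hf <-]; exists h => // x; exact: le_trans (fg x).
Qed.

(** Archimedean form of letting [I] tend to infinity in [x <= c / I]. *)
Lemma le0_of_natmul_bounded (R : realType) (x c : R) (I0 : nat) :
  (forall I, (I0 <= I)%N -> I%:R * x <= c) -> x <= 0.
Proof.
move=> h; rewrite leNgt; apply/negP => x0.
pose I := maxn I0 (Num.bound (`|c| / x)).
have := h I (leq_maxl _ _); rewrite leNgt => /negP; apply.
apply: le_lt_trans (ler_norm c) _; rewrite -ltr_pdivrMr //.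
apply: (@lt_le_trans _ _ (Num.bound (`|c| / x))%:R).
  by apply: archi_boundP; rewrite divr_ge0 // ltW.
by rewrite ler_nat leq_maxr.
Qed.

(** * The Poisson process on a grid of mesh [t0 / I] *)

Section Grid.
Variables (R : realType) (d : measure_display) (T : measurableType d).
Variables (P : probability T R) (N : R -> T -> nat) (lam : R -> R) (t0 lamc : R).
Hypothesis NHPP : is_NHPP P lam N.
Hypothesis t0_gt0 : 0 < t0.
Hypothesis lamc_gt0 : 0 < lamc.
Hypothesis lam_late : forall t, t0 <= t -> lam t = lamc.

Lemma NHPP_mono w s t : 0 <= s -> s <= t -> (N s w <= N t w)%N.
Proof. by case: NHPP => -[_ h] _ _ _ _; exact: h. Qed.

Lemma measurable_increment s t S : 0 <= s -> s <= t ->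
  measurable [set w | S (N t w - N s w)%N].
Proof.
case: NHPP => _ _ mN _ _ s0 st.
have -> : [set w | S (N t w - N s w)%N] =
    \bigcup_a \bigcup_(b in [set b | S (a - b)%N])
      ([set w | N t w = a] `&` [set w | N s w = b]).
  apply/seteqP; split => [w Sw|w [a _ [b Sab [/= -> ->]]]] //.
  by exists (N t w) => //; exists (N s w).
apply: bigcup_measurable => a _; apply: bigcup_measurable => b _.
by apply: measurableI; apply: mN => //; exact: le_trans st.
Qed.

Lemma cum_int_late s t : t0 <= s -> s <= t -> cum_int lam s t = lamc * (t - s).
Proof.
move=> ts st; rewrite /cum_int (@eq_Rintegral _ _ _ _ _ (cst lamc)); last first.
  move=> u; rewrite inE /= in_itv /= => /andP[su _].
  by rewrite lam_late // (le_trans ts).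
rewrite Rintegral_cst //= lebesgue_measure_itv /= lte_fin.
move: st; rewrite le_eqVlt => /predU1P[->|st]; first by rewrite ltxx subrr.
by rewrite st.
Qed.

Variable I : nat.
Hypothesis I_gt0 : (0 < I)%N.

(** [I] cells fill exactly the time up to [t0], so from cell [I] on the intensity is constant. *)
Definition mesh : R := t0 / I%:R.

Definition incr (i : nat) (w : T) : nat := (N (i.+1%:R * mesh) w - N (i%:R * mesh) w)%N.

Lemma mesh_gt0 : 0 < mesh.
Proof. by rewrite divr_gt0 // ltr0n. Qed.

Lemma mesh_ge0 i : 0 <= i%:R * mesh.
Proof. by rewrite mulr_ge0 // ltW // mesh_gt0. Qed.

Lemma measurable_incr i S : measurable (incr i @^-1` S).
Proof. exact: (measurable_increment _ (mesh_ge0 i) (grid_mono mesh_gt0 (leqnSn i))). Qed.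

Lemma indep_incr m (ks : nat -> nat) :
  P (\big[setI/setT]_(i < m) incr i @^-1` [set ks i]) =
  (\prod_(i < m) P (incr i @^-1` [set ks i]))%E.
Proof.
case: NHPP => _ _ _ _ /(_ m (fun i => i%:R * mesh) ks (mesh_ge0 0)); apply.
by move=> i _ /=; exact: (grid_mono mesh_gt0 (leqnSn i)).
Qed.

Lemma bits_incrE w : bits incr w = bit (N^~ w) mesh.
Proof.
apply/funext => i; rewrite /bits /bit /incr subn_eq0 eqn_leq.
by rewrite (NHPP_mono _ (mesh_ge0 i) (grid_mono mesh_gt0 (leqnSn i))) andbT.
Qed.

Definition pbar : R := expR (- (lamc * mesh)).

Lemma pbar_itv : 0 < pbar < 1.
Proof. by rewrite expR_gt0 expR_lt1 oppr_lt0 mulr_gt0 // mesh_gt0. Qed.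

Lemma bit_prob_late i : (I <= i)%N -> bit_prob P incr i = pbar.
Proof.
move=> Ii; have t0i : t0 <= i%:R * mesh.
  rewrite /mesh mulrCA ler_pMr // ler_pdivlMr ?ltr0n // mul1r ler_nat //.
have ii := grid_mono mesh_gt0 (leqnSn i).
case: NHPP => _ _ _ /(_ _ _ 0%N (mesh_ge0 i) ii) hP _.
rewrite /bit_prob (hP : P (incr i @^-1` [set 0%N]) = _) /=.
rewrite /Defs.poisson_pmf expr0 fact0 mulr1 divr1 cum_int_late //.
by rewrite -mulrBl -natrB // subSnn mul1r.
Qed.

(** Expected duration of the machine in time units, in closed form. *)
Definition grid_value (ks : seq nat) : R :=
  mesh * value (bit_prob P incr) pbar I 0 (0%N, ks).

Let Ev_busy ks i := Ev (bit_prob P incr) ks i (fun s => (busy s)%:R).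

Lemma integral_busy ks i :
  (\int[P]_w (mesh * (busy (run (bit (N^~ w) mesh) ks i))%:R)%:E =
   (mesh * Ev_busy ks i)%:E)%E.
Proof.
under eq_integral do rewrite -bits_incrE.
rewrite (@integral_run _ _ _ P incr measurable_incr indep_incr ks i
  (fun s => mesh * (busy s)%:R)); last by move=> s; rewrite mulr_ge0 // ltW // mesh_gt0.
by rewrite EvZ.
Qed.

Lemma measurable_busy ks i : measurable_fun setT
  (EFin \o (fun w => mesh * (busy (run (bit (N^~ w) mesh) ks i))%:R)).
Proof.
have := @measurable_fun_run R _ _ incr measurable_incr ks i
  (fun s => mesh * (busy s)%:R) setT.
by congr measurable_fun; apply/funext => w /=; rewrite bits_incrE.
Qed.

Let sum_bounds ks H hks IH :=
  @sum_Ev_busy_bounds R (bit_prob P incr) pbar I (bit_prob_itv P measurable_incr)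
    bit_prob_late pbar_itv I_gt0 ks H hks IH.

(** The measurable cell series dominates the completion time pathwise, and integrating it term by
    term leaves the expected busy counts. *)
Lemma Mexp_le_grid (k : R -> nat) cs : all (fun c => 0 <= c) cs ->
  all (fun j => (I <= j)%N) (map k cs) ->
  (forall c, c \in cs -> c <= (k c)%:R * mesh) ->
  (Mexp P N cs 0 <= (grid_value (map k cs))%:E)%E.
Proof.
move=> cs0 hks hk; rewrite /Mexp; under eq_integral do rewrite sube0.
have rc w t : 0 <= t -> exists2 e, 0 < e &
    forall u, t <= u -> u < t + e -> N u w = N t w.
  by case: NHPP => _ h _ _ _; exact: h.
apply: (@le_trans _ _ (\int[P]_w \sum_(0 <= i <oo)
    (mesh * (busy (run (bit (N^~ w) mesh) (map k cs) i))%:R)%:E)%E).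
  apply: ge0_le_integral_nonmeasurable => w; first exact: seq_end_ge.
  exact: (path_upper (NHPP_mono w) (rc w) mesh_gt0 cs0 hk).
rewrite integral_nneseries //; first last.
- by move=> i w _; rewrite lee_fin mulr_ge0 // ltW // mesh_gt0.
- by move=> i; exact: measurable_busy.
apply: lime_le.
  apply: is_cvg_nneseries => i _ _; apply: integral_ge0 => w _.
  by rewrite lee_fin mulr_ge0 // ltW // mesh_gt0.
near=> H.
under eq_bigr do rewrite integral_busy.
rewrite sumEFin lee_fin -mulr_sumr ler_pM2l ?mesh_gt0 // big_mkord.
by apply: (sum_bounds hks _).1; near: H; exact: nbhs_infty_ge.
Unshelve. all: by end_near. Qed.

Lemma Mexp_ge_grid (k : R -> nat) cs : all (fun c => 0 <= c) cs ->
  all (fun j => (I <= j)%N) (map k cs) ->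
  (forall c, c \in cs -> (k c).+2%:R * mesh <= c) ->
  ((grid_value (map k cs))%:E <= Mexp P N cs 0)%E.
Proof.
move=> cs0 hks hk; set ks := map k cs.
have hk' c : c \in cs -> (0 < k c)%N /\ (k c).+2%:R * mesh <= c.
  move=> ccs; split; last exact: hk.
  by apply: leq_trans I_gt0 _; apply: (allP hks); exact: map_f.
have partial H : ((mesh * \sum_(i < H) Ev_busy ks i)%:E <= Mexp P N cs 0)%E.
  rewrite /Mexp; under [in leRHS]eq_integral do rewrite sube0.
  apply: (@le_trans _ _ (\int[P]_w \sum_(i < H)
      (mesh * (busy (run (bit (N^~ w) mesh) ks i))%:R)%:E)%E).
    rewrite ge0_integral_sum //; first last.
    - by move=> i w _; rewrite lee_fin mulr_ge0 // ltW // mesh_gt0.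
    - by move=> i; exact: measurable_busy.
    rewrite (eq_bigr (fun i : 'I_H => (mesh * Ev_busy ks i)%:E)); last first.
      by move=> i _; exact: integral_busy.
    by rewrite sumEFin -mulr_sumr.
  apply: ge0_le_integral_nonmeasurable => w.
    by apply: sume_ge0 => i _; rewrite lee_fin mulr_ge0 // ltW // mesh_gt0.
  by rewrite sumEFin; apply: (path_lower (N^~ w) mesh_gt0 H cs0 hk').
case: (Mexp P N cs 0) partial => [M| |] partial; last 2 first.
- by rewrite leey.
- by have := partial 0%N.
rewrite lee_fin /grid_value mulrC -ler_pdivlMr ?mesh_gt0 // -subr_le0.
(* [H] times the deficit stays bounded as [H] grows, so the deficit is nonpositive. *)
apply: (@le0_of_natmul_bounded _ _ _ I) => H IH.
apply: le_trans (sum_bounds hks IH).2; rewrite ler_wpM2l // lerD2l lerN2.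
by rewrite ler_pdivlMr ?mesh_gt0 // mulrC -lee_fin.
Qed.

Definition cells_up (c : R) : nat := (Num.truncn (c / mesh)).+1.
(** The two cells dropped are the spare ones that the lower bound demands. *)
Definition cells_down (c : R) : nat := (Num.truncn (c / mesh)).-2.

Lemma truncn_mesh c : 0 <= c ->
  (Num.truncn (c / mesh))%:R * mesh <= c <= (Num.truncn (c / mesh)).+1%:R * mesh.
Proof.
move=> c0; have /andP[h1 h2] := truncn_itv (divr_ge0 c0 (ltW mesh_gt0)).
by rewrite -ler_pdivlMr ?mesh_gt0 // h1 -ler_pdivrMr ?mesh_gt0 // ltW.
Qed.

(** The second hypothesis says [2 * mesh <= c - t0], which leaves [cells_down c] at least [I]. *)
Lemma truncn_mesh_ge c : t0 <= c -> t0 *+ 2 <= I%:R * (c - t0) ->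
  (I.+2 <= Num.truncn (c / mesh))%N.
Proof.
move=> tc hc; have c0 : 0 <= c := le_trans (ltW t0_gt0) tc.
rewrite truncn_ge_nat; last by rewrite divr_ge0 // ltW // mesh_gt0.
rewrite ler_pdivlMr ?mesh_gt0 // /mesh mulrA ler_pdivrMr ?ltr0n //.
rewrite -addn2 natrD mulrDl; move: hc; rewrite mulrBr mulr2n; lra.
Qed.

(** Rounding up and down differ by three cells, hence by three terms of a geometric sum, each at
    most the last one. *)
Lemma run_cost_gap j :
  run_cost pbar j.+3 - run_cost pbar j <= 3 * pbar ^- j.+3.
Proof.
have /andP[p0 p1] := pbar_itv.
have -> : run_cost pbar j.+3 - run_cost pbar j =
    (1 + pbar + pbar ^+ 2) * pbar ^- j.+3.
  rewrite /run_cost !exprS; field.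
  by rewrite expf_neq0 ?subr_eq0 ?gt_eqF.
rewrite ler_wpM2r ?invr_ge0 ?exprn_ge0 ?(ltW p0) //; nra.
Qed.

(** The rounded length is at most [c + mesh <= c + t0], which makes the bound uniform in [I]. *)
Lemma pbar_cells_up c : 0 <= c -> pbar ^- cells_up c <= expR (lamc * (c + t0)).
Proof.
move=> c0; have /andP[h1 _] := truncn_mesh c0.
rewrite -expRM_natl -expRN ler_expR mulrN opprK mulrCA ler_pM2l //.
rewrite /cells_up -addn1 natrD mulrDl mul1r lerD //.
by rewrite ler_pdivrMr ?ltr0n // ler_peMr ?(ltW t0_gt0) // ler1n.
Qed.

Definition gap_bound (cs : seq R) : R := t0 * \sum_(c <- cs) 3 * expR (lamc * (c + t0)).

(** The age corrections at time zero are the same on both sides and cancel, leaving only the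
    differences of run costs. *)
Lemma grid_value_gap cs : {in cs, forall c, t0 <= c} ->
  {in cs, forall c, t0 *+ 2 <= I%:R * (c - t0)} ->
  grid_value (map cells_up cs) <= grid_value (map cells_down cs) + gap_bound cs / I%:R.
Proof.
move=> htc hc; rewrite -lerBlDl /grid_value -mulrBr.
have -> : gap_bound cs / I%:R = mesh * \sum_(c <- cs) 3 * expR (lamc * (c + t0)).
  by rewrite /gap_bound /mesh mulrAC.
rewrite ler_pM2l ?mesh_gt0 //.
apply: (@le_trans _ _ (\sum_(c <- cs)
    (run_cost pbar (cells_up c) - run_cost pbar (cells_down c)))).
  rewrite sumrB; case: (cs) => [|c l]; first by rewrite /value /= !big_nil.
  have e f : value (bit_prob P incr) pbar I 0 (0%N, map f (c :: l)) =
      \sum_(x <- c :: l) run_cost pbar (f x) + age_gain (bit_prob P incr) pbar I (I - 0) 0.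
    by rewrite (@value_busy _ _ _ _ _ (_, map f (c :: l)) isT) big_map.
  by rewrite !e opprD addrACA subrr addr0.
rewrite !big_seq; apply: ler_sum => c ccs.
have tc := htc _ ccs; have c0 : 0 <= c := le_trans (ltW t0_gt0) tc.
have := truncn_mesh_ge tc (hc _ ccs).
have := pbar_cells_up c0; rewrite /cells_up /cells_down.
case: (Num.truncn _) => [|[|j]] // hp _.
by rewrite (le_trans (run_cost_gap j)) // ler_wpM2l.
Qed.

Lemma perm_grid_value ks1 ks2 : perm_eq ks1 ks2 -> grid_value ks1 = grid_value ks2.
Proof.
move=> h; rewrite /grid_value /value /busy /= (perm_big _ h) /=.
by rewrite -!size_eq0 (perm_size h).
Qed.

Lemma Mexp_grid_bounds cs : {in cs, forall c, t0 <= c} ->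
  {in cs, forall c, t0 *+ 2 <= I%:R * (c - t0)} ->
  ((grid_value (map cells_down cs))%:E <= Mexp P N cs 0)%E /\
  (Mexp P N cs 0 <= (grid_value (map cells_up cs))%:E)%E.
Proof.
move=> htc hc.
have c0 c : c \in cs -> 0 <= c by move=> /htc; exact: le_trans (ltW t0_gt0).
have big c (ccs : c \in cs) := truncn_mesh_ge (htc _ ccs) (hc _ ccs).
split.
  apply: Mexp_ge_grid; first exact/allP.
    rewrite all_map; apply/allP => c ccs; have := big _ ccs.
    by rewrite /= /cells_down; case: (Num.truncn _) => [|[|j]].
  move=> c ccs; have /andP[h _] := truncn_mesh (c0 _ ccs).
  rewrite /cells_down; have := big _ ccs.
  by case: (Num.truncn (c / mesh)) h => [|[|j]].
apply: Mexp_le_grid; first exact/allP.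
  rewrite all_map; apply/allP => c ccs; have := big _ ccs.
  by rewrite /= /cells_up => /ltnW/ltnW/leq_trans; apply.
by move=> c ccs; have /andP[_] := truncn_mesh (c0 _ ccs).
Qed.

End Grid.

(** * Refining the mesh *)

Section Exchange.
Variables (R : realType) (d : measure_display) (T : measurableType d).
Variables (P : probability T R) (N : R -> T -> nat) (lam : R -> R) (t0 lamc : R).
Hypothesis NHPP : is_NHPP P lam N.
Hypothesis t0_gt0 : 0 < t0.
Hypothesis lamc_gt0 : 0 < lamc.
Hypothesis lam_late : forall t, t0 <= t -> lam t = lamc.

(** Finitely many tasks, each strictly longer than [t0], leave room for two cells above [t0] once
    the mesh is fine. *)
Lemma fine_mesh_exists (cs : seq R) : {in cs, forall c, t0 < c} ->
  exists I0, forall I : nat, (I0 <= I)%N ->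
    {in cs, forall c, t0 *+ 2 <= I%:R * (c - t0)}.
Proof.
elim: cs => [|c cs IH] h; first by exists 0%N.
have [I0 hI0] : exists I0, forall I : nat, (I0 <= I)%N ->
    {in cs, forall c, t0 *+ 2 <= I%:R * (c - t0)}.
  by apply: IH => x xcs; apply: h; rewrite inE xcs orbT.
have ct : 0 < c - t0 by rewrite subr_gt0 h // mem_head.
exists (maxn I0 (Num.bound (t0 *+ 2 / (c - t0)))) => I.
rewrite geq_max => /andP[h1 h2] x; rewrite inE => /predU1P[->|]; last exact: hI0.
rewrite -ler_pdivrMr //; apply: le_trans (_ : _ <= (Num.bound _)%:R) _.
  by apply/ltW/archi_boundP; rewrite divr_ge0 ?mulrn_wge0 // ltW.
by rewrite ler_nat.
Qed.

Lemma Mexp_fin (cs : seq R) : {in cs, forall c, t0 < c} -> Mexp P N cs 0 \is a fin_num.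
Proof.
move=> h; have [I0 hI0] := fine_mesh_exists h.
have hc : {in cs, forall c, t0 <= c} by move=> c /h /ltW.
have [h1 h2] := Mexp_grid_bounds NHPP t0_gt0 lamc_gt0 lam_late (ltn0Sn I0) hc
  (hI0 _ (leqnSn I0)).
by rewrite fin_numE -ltNye -ltey (lt_le_trans _ h1) ?ltNyr // (le_lt_trans h2) ?ltry.
Qed.

(** On a fine mesh the upper bound for [cs1] exceeds its lower grid value by at most [O(1 / I)];
    that lower value is shared by [cs2], whose expectation lies above it. *)
Lemma Mexp_perm_le (cs1 cs2 : seq R) : perm_eq cs1 cs2 -> {in cs1, forall c, t0 < c} ->
  (Mexp P N cs1 0 <= Mexp P N cs2 0)%E.
Proof.
move=> h12 h1.
have h2 : {in cs2, forall c, t0 < c} by move=> c; rewrite -(perm_mem h12); exact: h1.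
have [I0 hI0] := fine_mesh_exists h1.
rewrite -(fineK (Mexp_fin h1)) -(fineK (Mexp_fin h2)) lee_fin -subr_le0.
apply: (@le0_of_natmul_bounded _ _ (gap_bound t0 lamc cs1) I0.+1) => I I0I.
have I_gt0 : (0 < I)%N by case: I I0I.
have hc := hI0 I (ltnW I0I).
have hc2 : {in cs2, forall c, t0 *+ 2 <= I%:R * (c - t0)}.
  by move=> c; rewrite -(perm_mem h12); exact: hc.
have tc1 : {in cs1, forall c, t0 <= c} by move=> c /h1 /ltW.
have tc2 : {in cs2, forall c, t0 <= c} by move=> c /h2 /ltW.
have [_] := Mexp_grid_bounds NHPP t0_gt0 lamc_gt0 lam_late I_gt0 tc1 hc.
have [+ _] := Mexp_grid_bounds NHPP t0_gt0 lamc_gt0 lam_late I_gt0 tc2 hc2.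
rewrite -{1}(fineK (Mexp_fin h1)) -{1}(fineK (Mexp_fin h2)) !lee_fin => lo up.
rewrite mulrC -ler_pdivlMr ?ltr0n // lerBlDl; apply: (le_trans up).
apply: le_trans (grid_value_gap P N t0_gt0 lamc_gt0 I_gt0 tc1 hc) _.
rewrite lerD2r; apply: le_trans lo.
by rewrite (perm_grid_value _ _ _ _ _ (perm_map (cells_down t0 I) h12)).
Qed.

Lemma Mexp_perm (cs1 cs2 : seq R) : perm_eq cs1 cs2 -> {in cs1, forall c, t0 < c} ->
  Mexp P N cs1 0 = Mexp P N cs2 0.
Proof.
move=> h12 h1; apply/eqP; rewrite eq_le !Mexp_perm_le // 1?perm_sym //.
by move=> c; rewrite -(perm_mem h12); exact: h1.
Qed.

End Exchange.

Theorem theorem3 (R : realType) (d : measure_display) (T : measurableType d)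
  (P : probability T R) (N : R -> T -> nat)
  (lambar : R) (f : R -> R) (t0 : R) (n : nat) (a : 'I_n -> R) (pi : 'S_n) :
  0 < lambar ->
  (forall t, 0 <= t -> 0 < f t) ->
  (forall t, 0 < t -> derivable f t 1) ->
  (exists l : R, (fun h : R => h^-1 * (f h - f 0)) @ (0 : R)^'+ --> l) ->
  (exists2 m : R, 0 < m & forall t, 0 <= t -> m <= f t) ->
  (exists B : R, forall t, 0 <= t -> f t <= B) ->
  0 < t0 ->
  (forall t, t0 < t -> lambar * f t = lambar * f t0) ->
  (forall i, 0 < a i) ->
  (forall i, t0 < a i) ->
  is_NHPP P (fun t => lambar * f t) N ->
  Mexp P N [seq a i | i <- enum 'I_n] 0 = Mexp P N [seq a (pi i) | i <- enum 'I_n] 0.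
Proof.
move=> lb_gt0 f_gt0 _ _ _ _ t0_gt0 f_late _ a_gt HN.
apply: (@Mexp_perm _ _ _ _ _ _ t0 (lambar * f t0) HN t0_gt0).
- by rewrite mulr_gt0 // f_gt0 // ltW.
(* Constancy is given strictly after [t0]; at [t0] itself it is trivial. *)
- by move=> t; rewrite le_eqVlt => /predU1P[<-|/f_late].
- rewrite (map_comp a pi) perm_map // perm_sym uniq_perm ?enum_uniq //.
    by rewrite map_inj_uniq ?enum_uniq //; exact: perm_inj.
  move=> i; rewrite mem_enum; apply/mapP; exists (pi^-1%g i); first by rewrite mem_enum.
  by rewrite permKV.
- by move=> _ /mapP[i _ ->].
Qed.
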